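(* Let $G$ be the graph obtained from the dodecahedron graph, embedded in the plane with its 12 pentagonal faces, by inserting into each face five mutually crossing edges, namely the five diagonals of the pentagon (so that the five vertices of each face become pairwise adjacent). Then $G$ is an optimal 2-planar graph and $G$ is 4-extendable.
   Context: All graphs are finite, simple and undirected. The dodecahedron graph is the 1-skeleton of the regular dodecahedron (20 vertices, 30 edges, 12 faces each bounded by a 5-cycle). A graph is 2-planar if it can be drawn in the plane such that each edge is crossed at most twice (crossed by at most two other edges). A 2-planar graph $G$ has at most $5|V(G)|-10$ edges, and $G$ is called an optimal 2-planar graph if it is 2-planar and $|E(G)| = 5|V(G)|-10$. For an integer $n\ge 1$, a connected graph with at least $2n+2$ vertices is $n$-extendable if it contains a perfect matching and every matching of size $n$ is a subset of a perfect matching. *)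

(* Defs.v *)
From HB Require Import structures.
From mathcomp Require Import all_boot all_order all_algebra.
From mathcomp Require Import all_classical all_reals all_analysis.
Import Order.TTheory GRing.Theory Num.Theory.
Import numFieldNormedType.Exports.

Set Implicit Arguments.
Unset Strict Implicit.
Unset Printing Implicit Defensive.

Record sgraph := SGraph {
  vertex :> finType;
  adj : rel vertex;
  adj_sym : symmetric adj;
  adj_irrefl : irreflexive adj }.

Definition edges (G : sgraph) : {set {set G}} :=
  [set A : {set G} | [exists x : G, exists y : G,
     adj x y && (A == [set x; y]%SET)]]%SET.

Definition connected_graph (G : sgraph) : Prop :=
  forall x y : G, connect (@adj G) x y.

Definition matching (G : sgraph) (M : {set {set G}}) : bool :=
  (M \subset edges G) && finset.trivIset M.

Definition perfect_matching (G : sgraph) (M : {set {set G}}) : bool :=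
  matching M && (finset.cover M == [set: G]%SET).

Definition extendable (n : nat) (G : sgraph) : Prop :=
  [/\ connected_graph G,
      2 * n + 2 <= #|G|,
      exists M : {set {set G}}, perfect_matching M
    & forall M : {set {set G}}, matching M -> #|M| = n ->
        exists2 P : {set {set G}}, perfect_matching P & M \subset P].

(* A drawing in the plane R * R: vertices are distinct points, and each edge is
   a simple arc, parametrised by [0, 1], that joins its two ends and has no
   vertex in its interior. The function [curve] is only constrained on edges. *)
Record drawing (R : realType) (G : sgraph) := Drawing {
  point_of : G -> R * R;
  curve : {set G} -> R -> R * R;
  point_of_inj : injective point_of;
  curve_continuous : forall A, A \in edges G ->
    {within `[0%R, 1%R], continuous (curve A)}%classic;
  curve_simple : forall A, A \in edges G ->
    {in `[0, 1]%R &, injective (curve A)};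
  curve_ends : forall A, A \in edges G ->
    ([set curve A 0%R; curve A 1%R] = point_of @` [set` A])%classic;
  curve_avoids : forall A (t : R) x, A \in edges G ->
    t \in `]0, 1[%R -> curve A t <> point_of x }.

Definition arc_interior (R : realType) (G : sgraph) (d : drawing R G)
    (A : {set G}) : set (R * R) :=
  (curve d A @` `]0%R, 1%R[)%classic.

(* The crossings on an edge A are the pairs (B, p) where B is another edge and
   p is a common interior point of A and B. Hence an edge that meets A several
   times counts once per point, several edges through the same point of A each
   count, tangential contacts count, and so do crossings between adjacent
   edges. *)
Definition crossings (R : realType) (G : sgraph) (d : drawing R G)
    (A : {set G}) : set ({set G} * (R * R)) :=
  [set Bp | [/\ Bp.1 \in edges G, Bp.1 != A,
                arc_interior d A Bp.2 & arc_interior d Bp.1 Bp.2]]%classic.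

Definition kplanar (R : realType) (k : nat) (G : sgraph) : Prop :=
  exists d : drawing R G,
    forall A, A \in edges G -> (crossings d A #<= `I_k)%card.

Definition optimal_2planar (R : realType) (G : sgraph) : Prop :=
  kplanar R 2 G /\ (#|edges G|%:Z = 5 * #|G|%:Z - 10)%R.

(* The faces of the dodecahedron, each as the cyclic sequence of its vertices.
   The faces 0-1-2-3-4 and 15-16-17-18-19 are opposite; for i < 5, the vertex
   5 + i is adjacent to i, and 10 + i to 15 + i.
   [dodecahedron_facesP] below checks that this is the dodecahedron. *)
Definition dodecahedron_faces : seq (seq nat) :=
  [:: [:: 0; 1; 2; 3; 4];
      [:: 0; 1; 6; 10; 5];
      [:: 1; 2; 7; 11; 6];
      [:: 2; 3; 8; 12; 7];
      [:: 3; 4; 9; 13; 8];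
      [:: 4; 0; 5; 14; 9];
      [:: 15; 16; 11; 6; 10];
      [:: 16; 17; 12; 7; 11];
      [:: 17; 18; 13; 8; 12];
      [:: 18; 19; 14; 9; 13];
      [:: 19; 15; 10; 5; 14];
      [:: 15; 16; 17; 18; 19] ].

Definition face_side (f : seq nat) (x y : nat) : bool :=
  [&& x \in f, y \in f & (next f x == y) || (next f y == x)].

Definition face_diagonal (f : seq nat) (x y : nat) : bool :=
  [&& x \in f, y \in f, x != y & ~~ face_side f x y].

Definition dodecahedron_adj (x y : nat) : bool :=
  has (fun f => face_side f x y) dodecahedron_faces.

Definition face_diagonals_adj (x y : nat) : bool :=
  has (fun f => face_diagonal f x y) dodecahedron_faces.

(* The faces are twelve pentagons on the vertices 0, .., 19; every vertex has
   degree 3 and lies on three faces, every edge lies on exactly two faces, and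
   there are 30 edges. Together with [dodecahedron_connected], this says that
   the pentagons form a closed connected surface with Euler characteristic
   20 - 30 + 12 = 2, that is, a sphere tiled by pentagons, three at each
   vertex. *)
Lemma dodecahedron_facesP :
  [/\ size dodecahedron_faces = 12,
      all (fun f => [&& size f == 5, uniq f & all (gtn 20) f])
        dodecahedron_faces,
      all (fun x => (count (dodecahedron_adj x) (iota 0 20) == 3) &&
                    (count (fun f => x \in f) dodecahedron_faces == 3))
        (iota 0 20),
      all (fun x => all (fun y => dodecahedron_adj x y ==>
          (count (fun f => face_side f x y) dodecahedron_faces == 2))
        (iota 0 20)) (iota 0 20)
    & count (fun p => (p.1 < p.2) && dodecahedron_adj p.1 p.2)
        [seq (x, y) | x <- iota 0 20, y <- iota 0 20] = 30].
Proof. by split; vm_compute. Qed.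

Lemma dodecahedron_connected :
  perm_eq (iter 5 (fun s => [seq y <- iota 0 20 |
      (y \in s) || has (fun x => dodecahedron_adj x y) s]) [:: 0]) (iota 0 20).
Proof. by vm_compute. Qed.

Lemma face_side_sym f : symmetric (face_side f).
Proof. by move=> x y; rewrite /face_side orbC andbCA. Qed.

Lemma face_diagonal_sym f : symmetric (face_diagonal f).
Proof.
by move=> x y; rewrite /face_diagonal face_side_sym eq_sym andbCA.
Qed.

Definition dodecahedron_diag_adj : rel 'I_20 :=
  fun x y => dodecahedron_adj x y || face_diagonals_adj x y.

Lemma dodecahedron_diag_adj_sym : symmetric dodecahedron_diag_adj.
Proof.
move=> x y; rewrite /dodecahedron_diag_adj; congr (_ || _); apply: eq_has => f.
  exact: face_side_sym.
exact: face_diagonal_sym.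
Qed.

Lemma dodecahedron_diag_adj_irrefl : irreflexive dodecahedron_diag_adj.
Proof.
have: all (fun x => ~~ (dodecahedron_adj x x || face_diagonals_adj x x))
  (iota 0 20) by vm_compute.
by move=> /allP irr x; apply/negbTE/irr; rewrite mem_iota /= add0n.
Qed.

Definition dodecahedron_with_diagonals : sgraph :=
  SGraph dodecahedron_diag_adj_sym dodecahedron_diag_adj_irrefl.

Lemma dodecahedron_diag_adjE (x y : 'I_20) :
  dodecahedron_diag_adj x y = (x != y) &&
    has (fun f : seq nat => (val x \in f) && (val y \in f))
      dodecahedron_faces.
Proof.
have: all (fun x => all (fun y => (dodecahedron_adj x y ||
    face_diagonals_adj x y) == (x != y) &&
      has (fun f : seq nat => (x \in f) && (y \in f)) dodecahedron_faces)
  (iota 0 20)) (iota 0 20) by vm_compute.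
move=> /allP /(_ (val x)); rewrite mem_iota ltn_ord => /(_ isT) /allP.
by move=> /(_ (val y)); rewrite mem_iota ltn_ord => /(_ isT) /eqP.
Qed.

(* Main.v *)
Require Import Defs.
From Stdlib Require Import ZArith.
From mathcomp Require Import all_boot all_order all_algebra.
From mathcomp Require Import all_classical all_reals all_analysis.
From mathcomp Require Import ring lra ssrZ zify.
Import Order.TTheory GRing.Theory Num.Theory.
Import numFieldNormedType.Exports.

(* Place the vertices at integer points of space close to those of a regular
   dodecahedron, draw every edge as a straight segment, and project radially to
   the sphere and then stereographically to the plane. Two edges then cross only
   if the plane cones that they span meet in a ray, which the signs of four
   determinants decide, and in at most one point; a finite check shows that each
   edge is crossed by at most two others.

   For 4-extendability more is true: whichever 8 vertices are removed, the
   remaining 12 have a perfect matching. This is checked for all 8-sets. *)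

Set Implicit Arguments.
Unset Strict Implicit.
Unset Printing Implicit Defensive.

Local Notation cover := finset.cover.
Local Notation dodeca := dodecahedron_with_diagonals.

(** * Matchings *)

Section Matchings.

Variable G : sgraph.
Implicit Types (A B : {set G}) (M N : {set {set G}}).

Lemma edgesP A :
  reflect (exists x y, adj x y /\ A = [set x; y]%SET) (A \in edges G).
Proof.
rewrite inE; apply: (iffP existsP) => [[x /existsP[y /andP[xy /eqP->]]]|].
  by exists x, y.
by move=> [x [y [xy ->]]]; exists x; apply/existsP; exists y; rewrite xy eqxx.
Qed.

Lemma adj_neq (x y : G) : adj x y -> x != y.
Proof. by apply: contraTneq => ->; rewrite adj_irrefl. Qed.

Lemma card_edge A : A \in edges G -> #|A| = 2.
Proof. by move=> /edgesP[x [y [/adj_neq xy ->]]]; rewrite cards2 xy. Qed.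

Lemma card_cover_matching M : matching M -> #|cover M| = 2 * #|M|.
Proof.
move=> /andP[/fintype.subsetP ME]; rewrite /finset.trivIset => /eqP <-.
under eq_bigr => A AM do rewrite (card_edge (ME _ AM)).
by rewrite sum_nat_const mulnC.
Qed.

Lemma matchingU M N : matching M -> matching N ->
  [disjoint cover M & cover N] -> matching (M :|: N)%SET.
Proof.
move=> /andP[ME tM] /andP[NE tN] MN; rewrite /matching finset.subUset ME NE /=.
exact: trivIsetU.
Qed.

Lemma coverU M N : cover (M :|: N)%SET = (cover M :|: cover N)%SET.
Proof. exact: finset.bigcup_setU. Qed.

Lemma matching_set1 A : A \in edges G -> matching [set A]%SET.
Proof.
move=> AE; rewrite /matching finset.sub1set AE /=.
by apply/finset.trivIsetP => B C /finset.set1P-> /finset.set1P->; rewrite eqxx.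
Qed.

Lemma cover_set1 A : cover [set A]%SET = A.
Proof. exact: big_set1. Qed.

End Matchings.

(* [pairable e n l] searches for a perfect matching of [l] by at most [n] pairs.
   The nested [if]s here and in [all_pairable] are deliberate: [&&] and [||] do
   not short-circuit under call-by-value evaluation. *)
Fixpoint pairable (e : rel nat) (n : nat) (l : seq nat) : bool :=
  if l isn't x :: r then true else
  if n isn't n'.+1 then false else
  (fix pair_with s :=
    if s isn't y :: s' then false else
    if e x y then
      if pairable e n' (rem y r) then true else pair_with s'
    else pair_with s') r.

(* Runs [pairable] on [W] extended by any [m] elements of [U], where [U] is
   expected to have [m + k] elements. *)
Fixpoint all_pairable (e : rel nat) (n m k : nat) (W U : seq nat) : bool :=
  if U isn't u :: U' then
    if m isn't 0 then true else if k isn't 0 then true else pairable e n W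
  else
  if (if k isn't k'.+1 then true else all_pairable e n m k' W U') then
    if m isn't m'.+1 then true else all_pairable e n m' k (u :: W) U'
  else false.

Lemma pairable_cons e n x r : pairable e n.+1 (x :: r) ->
  exists y, [/\ y \in r, e x y & pairable e n (rem y r)].
Proof.
(* Only the list scanned by the inner loop and the one in [y \in r] are generalised; both
   occurrences of [rem y r] keep the full list. *)
move=> /=; move: {2 3}r => s; elim: s => // y s IHs.
case exy: (e x y); last by move=> /IHs[z [zs]]; exists z; rewrite inE zs orbT.
case ny: (pairable e n (rem y r)).
  by exists y; rewrite mem_head.
by move=> /IHs[z [zs]]; exists z; rewrite inE zs orbT.
Qed.

(** The predicate [p] singles out one branch of the recursion: elements satisfying it are pushed
    onto [W], the others are dropped. Pushing reverses the order, hence [catrev]. *)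
Lemma all_pairableP e n m k W U (p : pred nat) :
  all_pairable e n m k W U -> count p U = m -> count (predC p) U = k ->
  pairable e n (catrev [seq u <- U | p u] W).
Proof.
elim: U m k W => [|u U IHU] m k W /=; first by case: m k => [|m] [|k].
case pu: (p u) => /=; rewrite ?add0n ?add1n.
  case: m => // m; case: ifP => // _ allU [mU] kU.
  exact: IHU allU _ _.
case: k => // k; case: ifP => // allU _ mU [kU].
exact: IHU allU _ _.
Qed.

(** The pair found for the head is joined to a matching of the rest. Since [f] is injective on the
    duplicate-free list [l], the two covers are disjoint. *)
Lemma pairable_matching (G : sgraph) (f : nat -> G) (e : rel nat) n l :
    {in l &, injective f} -> {in l &, forall x y, e x y -> adj (f x) (f y)} ->
    uniq l -> pairable e n l ->
  exists2 M : {set {set G}}, matching M & cover M = [set x in map f l]%SET.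
Proof.
elim: n l => [|n IHn] [|x r] // finj fadj luniq lpair.
- exists finset.set0; last by rewrite /cover big_set0; apply/setP=> z; rewrite !inE.
  by rewrite /matching finset.sub0set; apply/finset.trivIsetP => A; rewrite inE.
- exists finset.set0; last by rewrite /cover big_set0; apply/setP=> z; rewrite !inE.
  by rewrite /matching finset.sub0set; apply/finset.trivIsetP => A; rewrite inE.
have [y [yr exy pr]] := pairable_cons lpair.
have {luniq}/andP[xr ur] := luniq.
have sub : {subset rem y r <= x :: r}.
  by move=> z /mem_rem zr; rewrite inE zr orbT.
have yl : y \in x :: r by rewrite inE yr orbT.
have [||||M Mm Mc] := IHn (rem y r) => //.
- by move=> a b /sub al /sub bl; apply: finj.
- by move=> a b /sub al /sub bl; apply: fadj.
- exact: rem_uniq.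
have xyE : [set f x; f y]%SET \in edges G.
  by apply/edgesP; exists (f x), (f y); split=> //; apply: fadj; rewrite ?mem_head.
exists ([set [set f x; f y]] :|: M)%SET.
  apply: matchingU => //; first exact: matching_set1.
  rewrite cover_set1 Mc disjoint_subset; apply/fintype.subsetP => z.
  rewrite !inE => /orP[]/eqP->; apply/mapP => -[t tr].
    move=> /(finj _ _ (mem_head _ _) (sub _ tr)) xt.
    by move: tr => /mem_rem; rewrite -xt (negbTE xr).
  move=> /(finj _ _ yl (sub _ tr)) yt.
  by move: tr; rewrite -yt mem_rem_uniqF.
rewrite coverU cover_set1 Mc; apply/setP => z; rewrite !inE.
by rewrite (eq_mem_map f (perm_mem (perm_to_rem yr))) /= inE orbA.
Qed.

(** * Connectedness and 4-extendability of the dodecahedron with diagonals *)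

(** Evaluated once, so that the exhaustive search looks adjacency up instead of scanning the
    faces. *)
Definition adj_table : seq bitseq := Eval vm_compute in
  [seq [seq dodecahedron_adj x y || face_diagonals_adj x y | y <- iota 0 20]
     | x <- iota 0 20].

Definition table_adj x y := nth false (nth [::] adj_table x) y.

Lemma table_adjE (x y : dodeca) : table_adj x y = adj x y.
Proof.
have /allP/(_ (val x)) : all (fun x => all (fun y => table_adj x y ==
    (dodecahedron_adj x y || face_diagonals_adj x y)) (iota 0 20)) (iota 0 20).
  by vm_compute.
rewrite mem_iota ltn_ord => /(_ isT)/allP/(_ (val y)).
by rewrite mem_iota ltn_ord => /(_ isT)/eqP.
Qed.

Lemma dodeca_connected : connected_graph dodeca.
Proof.
have con0 (x : dodeca) : connect (@adj dodeca) ord0 x.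
  have [n] := ubnP (val x); elim: n x => // n IHn x; rewrite ltnS => xn.
  have [->|x0] := eqVneq x ord0; first exact: connect0.
  (* Every vertex other than 0 has a neighbour with a smaller number, so descent ends at 0. *)
  have /allP/(_ (val x)) : all (fun x => has (table_adj^~ x) (iota 0 x))
    (iota 1 19) by vm_compute.
  rewrite mem_iota ltn_ord andbT lt0n.
  move=> /(_ x0)/hasP[y]; rewrite mem_iota add0n => /andP[_ yx].
  have y20 : y < 20 := ltn_trans yx (ltn_ord x).
  rewrite (table_adjE (Ordinal y20) x) => yxadj.
  exact: connect_trans (IHn (Ordinal y20) (leq_trans yx xn)) (connect1 yxadj).
move=> x y; apply: connect_trans (con0 y).
by rewrite (sym_connect_sym (@adj_sym dodeca)).
Qed.

(** All 125970 choices of 12 vertices to keep and 8 to remove; 6 pairs match the kept ones. *)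
Lemma dodeca_all_pairable : all_pairable table_adj 6 12 8 [::] (iota 0 20).
Proof. by vm_compute. Qed.

Lemma dodeca_matching_setC (S : {set dodeca}) : #|S| = 8 ->
  exists2 M : {set {set dodeca}}, matching M & cover M = (~: S)%SET.
Proof.
move=> S8.
pose p (x : nat) := (inord x : 'I_20) \notin S.
have countS (q : pred 'I_20) :
    count (fun x : nat => q (inord x)) (iota 0 20) = #|q|.
  rewrite cardE /enum_mem size_filter -val_enum_ord count_map enumT.
  by apply: eq_count => x /=; rewrite inord_val.
have pS : count p (iota 0 20) = 12.
  rewrite (countS (fun x => x \notin S)).
  have SC : #|(~: S)%SET| = 12.
    by have := cardsC S; rewrite S8 card_ord; lia.
  apply: etrans SC.
  by apply: eq_card => x; rewrite !inE.
have npS : count (predC p) (iota 0 20) = 8.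
  by have := count_predC p (iota 0 20); rewrite pS size_iota; lia.
have := all_pairableP dodeca_all_pairable pS npS; rewrite catrevE cats0 => pl.
set l := rev _ in pl.
have lE x : (x \in l) = (x < 20) && p x.
  by rewrite mem_rev mem_filter mem_iota andbC.
have [|||M Mm Mc] := @pairable_matching dodeca (fun x => inord x : 'I_20)
   table_adj 6 l _ _ _ pl.
- move=> x y; rewrite !lE => /andP[x20 _] /andP[y20 _] /(congr1 val).
  by rewrite /= !inordK.
- move=> x y; rewrite !lE => /andP[x20 _] /andP[y20 _].
  by rewrite -table_adjE !inordK.
- by rewrite rev_uniq filter_uniq // iota_uniq.
exists M => //; rewrite Mc; apply/setP => x; rewrite !inE.
apply/mapP/idP => [[y]|xS]; first by rewrite lE => /andP[_ yS] ->.
exists (val x); last by rewrite inord_val.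
by rewrite lE ltn_ord /p inord_val.
Qed.

Lemma dodeca_extendable : extendable 4 dodeca.
Proof.
(* Only the number of covered vertices matters: a matching of the 12 remaining ones completes
   [M]. *)
have ext (M : {set {set dodeca}}) : matching M -> #|cover M| = 8 ->
    exists2 P : {set {set dodeca}}, perfect_matching P & M \subset P.
  move=> Mm /dodeca_matching_setC[N Nm Nc].
  exists (M :|: N)%SET; last exact: finset.subsetUl.
  rewrite /perfect_matching coverU Nc finset.setUCr eqxx andbT.
  apply: matchingU => //; rewrite Nc disjoint_subset; apply/fintype.subsetP => x.
  by rewrite !inE negbK.
split.
- exact: dodeca_connected.
- by rewrite card_ord.
- have [||||M Mm Mc] := @pairable_matching dodeca (fun x => inord x : 'I_20)
     table_adj 10 (iota 0 20).
  + move=> x y; rewrite !mem_iota => x20 y20 /(congr1 val).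
    by rewrite /= !inordK.
  + move=> x y; rewrite !mem_iota => x20 y20.
    by rewrite -table_adjE !inordK.
  + by vm_compute.
  + by vm_compute.
  exists M; rewrite /perfect_matching Mm Mc; apply/eqP/setP => x.
  rewrite finset.in_setT inE; apply/mapP; exists (val x); last by rewrite inord_val.
  by rewrite mem_iota ltn_ord.
- by move=> M Mm M4; apply: ext => //; rewrite card_cover_matching // M4.
Qed.

(** * Projecting segments from space to the plane *)

Local Open Scope ring_scope.

Section Vectors.

Variable T : pzRingType.

Definition vec3 : Type := T * T * T.
Implicit Types u v w : vec3.

(** The third coordinate of the cross product. It is nonzero exactly when [u] and [v] span a plane
    that does not contain the third axis, on which the pole of projection lies. *)
Definition cross2 u v := u.1.1 * v.1.2 - u.1.2 * v.1.1.

Definition det3 u v w :=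
  u.1.1 * (v.1.2 * w.2 - v.2 * w.1.2) - u.1.2 * (v.1.1 * w.2 - v.2 * w.1.1)
  + u.2 * (v.1.1 * w.1.2 - v.1.2 * w.1.1).

Definition lin2 (r s : T) u v : vec3 :=
  (r * u.1.1 + s * v.1.1, r * u.1.2 + s * v.1.2, r * u.2 + s * v.2).

End Vectors.

Definition map_vec3 (T U : Type) (f : T -> U) (v : T * T * T) : U * U * U :=
  (f v.1.1, f v.1.2, f v.2).

(* The cones spanned by [a, b] and by [c, d] meet in a ray that is interior to
   both. The first two conditions say this up to sign. With [x] the cross
   product, [(a x b) x (c x d)] equals both [det(a,b,d) c - det(a,b,c) d] and
   [det(c,d,a) b - det(c,d,b) a], so that the third condition rules out that
   the cones contain opposite rays. *)
Definition properly_cross (T : numDomainType) (a b c d : vec3 T) :=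
  [&& det3 a b c * det3 a b d < 0, det3 c d a * det3 c d b < 0
    & det3 a b d * det3 c d b < 0].

(** * A sign criterion for crossing cones *)

Section Cones.

Variable R : realFieldType.
Implicit Types a b c d : vec3 R.

Lemma opposite_signs (r s x y : R) : 0 < r -> 0 < s -> x != 0 ->
  r * x + s * y = 0 -> x * y < 0.
Proof.
move=> r0 s0 x0 rs0.
have -> : x * y = - (r / s * x ^+ 2).
  have -> : y = - (r / s * x).
    apply: (mulfI (lt0r_neq0 s0)); rewrite mulrN mulrA mulrCA divff ?lt0r_neq0 //.
    by rewrite mulr1; apply/eqP; rewrite -addr_eq0 addrC rs0.
  by rewrite mulrN mulrCA expr2.
by rewrite oppr_lt0 mulr_gt0 ?divr_gt0 // lt_def sqr_ge0 sqrf_eq0 x0.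
Qed.

(** Determinants of the common vector against [a, b], against [c, d] and against [b, d] give three
    vanishing combinations with positive coefficients, hence three pairs of opposite signs. The
    nonvanishing hypothesis excludes four coplanar vectors. *)
Lemma cones_meet_properly_cross a b c d (r s r' s' : R) :
    0 < r -> 0 < s -> 0 < r' -> 0 < s' ->
    (det3 a b c != 0) || (det3 a b d != 0) ->
  lin2 r s a b = lin2 r' s' c d -> properly_cross a b c d.
Proof.
move=> r0 s0 r'0 s'0 nz e.
have eab : r' * det3 a b c + s' * det3 a b d = 0.
  transitivity (det3 a b (lin2 r' s' c d)); last rewrite -e;
  by rewrite /det3 /lin2 /=; ring.
have ecd : r * det3 c d a + s * det3 c d b = 0.
  transitivity (det3 c d (lin2 r s a b)); last rewrite e;
  by rewrite /det3 /lin2 /=; ring.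
have ebd : r * det3 a b d + r' * det3 c d b = 0.
  transitivity (det3 (lin2 r s a b) b d - det3 (lin2 r' s' c d) b d);
    last by rewrite e subrr.
  by rewrite /det3 /lin2 /=; ring.
have nz_abd : det3 a b d != 0.
  apply: contraTneq nz => abd; move: eab.
  rewrite abd mulr0 addr0 eqxx orbF => /eqP.
  by rewrite mulf_eq0 (gt_eqF r'0) /= => ->.
have abd_cdb := opposite_signs r0 r'0 nz_abd ebd.
have nz_cdb : det3 c d b != 0.
  by apply: contraTneq abd_cdb => ->; rewrite mulr0 ltxx.
rewrite /properly_cross abd_cdb andbT mulrC; apply/andP; split.
  by apply: (opposite_signs s'0 r'0 nz_abd); rewrite addrC.
by rewrite mulrC; apply: (opposite_signs s0 r0 nz_cdb); rewrite addrC.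
Qed.

End Cones.

(** * Radial and stereographic projection of segments *)

Section Projection.

Variable R : realType.
Implicit Types v w a b c d : vec3 R.

Definition seg a b (t : R) : vec3 R := lin2 (1 - t) t a b.

Definition pole_dist v := Num.sqrt (v.1.1 ^+ 2 + v.1.2 ^+ 2 + v.2 ^+ 2) - v.2.

(* Radial projection to the unit sphere followed by stereographic projection
   from (0, 0, 1). *)
Definition sproj v : R * R := (v.1.1 / pole_dist v, v.1.2 / pole_dist v).

Definition off_axis v := (v.1.1 != 0) || (v.1.2 != 0).

Lemma pole_dist_gt0 v : off_axis v -> 0 < pole_dist v.
Proof.
move=> v0; rewrite subr_gt0 (le_lt_trans (ler_norm _)) // -sqrtr_sqr.
have h : 0 < v.1.1 ^+ 2 + v.1.2 ^+ 2.
  rewrite lt_def addr_ge0 ?paddr_eq0 ?sqr_ge0 // !sqrf_eq0 negb_and.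
  by case/orP: v0 => ->; rewrite ?orbT.
by rewrite ltr_sqrt ?ltrDr // ltr_wpDr ?sqr_ge0.
Qed.

(** After division by [pole_dist] the third coordinate is a function of the first two, so the
    vectors differ by the ratio of their values of [pole_dist]. The term [lin2 k 0 w w] is the
    multiple [k w]. *)
Lemma sproj_inj v w : off_axis v -> off_axis w -> sproj v = sproj w ->
  exists2 k, 0 < k & v = lin2 k 0 w w.
Proof.
move=> /pole_dist_gt0 v0 /pole_dist_gt0 w0 [e1 e2].
(* On the cone [pole_dist v = 1] one has x^2 + y^2 = 1 + 2 z. *)
have height u : 0 < pole_dist u -> u.2 / pole_dist u
    = ((u.1.1 / pole_dist u) ^+ 2 + (u.1.2 / pole_dist u) ^+ 2 - 1) / 2.
  move=> u0; have un0 := lt0r_neq0 u0.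
  have /eqP : (pole_dist u + u.2) ^+ 2 = u.1.1 ^+ 2 + u.1.2 ^+ 2 + u.2 ^+ 2.
    rewrite /pole_dist subrK sqr_sqrtr //.
    by rewrite !addr_ge0 // sqr_ge0.
  move: (pole_dist u) un0 => D Dn0 /eqP e.
  have {}e : u.1.1 ^+ 2 + u.1.2 ^+ 2 = D ^+ 2 + 2 * D * u.2.
    by move: e; rewrite sqrrD; lra.
  by rewrite !exprMn -mulrDl e exprVn; field.
have e3 : v.2 / pole_dist v = w.2 / pole_dist w by rewrite !height // e1 e2.
exists (pole_dist v / pole_dist w); first exact: divr_gt0.
have scale x y : x / pole_dist v = y / pole_dist w ->
    x = pole_dist v / pole_dist w * y + 0 * y.
  move=> /(canRL (divfK (lt0r_neq0 v0))) ->.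
  by rewrite mul0r addr0 mulrC mulrCA mulrC.
rewrite /lin2 -(scale _ _ e1) -(scale _ _ e2) -(scale _ _ e3).
by case: (v) => [[]].
Qed.

(** If the first two coordinates vanished, their [cross2] with [a] and with [b] would give
    [t * cross2 a b = 0] and [(1 - t) * cross2 a b = 0], whose sum is [cross2 a b = 0]. *)
Lemma seg_off_axis a b t : cross2 a b != 0 -> off_axis (seg a b t).
Proof.
apply: contraNT; rewrite negb_or !negbK /= => /andP[/eqP e1 /eqP e2].
have ta : t * cross2 a b = 0.
  transitivity (a.1.1 * ((1 - t) * a.1.2 + t * b.1.2)
              - a.1.2 * ((1 - t) * a.1.1 + t * b.1.1)); last by rewrite e1 e2; ring.
  by rewrite /cross2; ring.
have tb : (1 - t) * cross2 a b = 0.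
  transitivity (b.1.2 * ((1 - t) * a.1.1 + t * b.1.1)
              - b.1.1 * ((1 - t) * a.1.2 + t * b.1.2)); last by rewrite e1 e2; ring.
  by rewrite /cross2; ring.
by rewrite -[cross2 a b]mul1r -(subrK t 1) mulrDl ta tb addr0.
Qed.

Lemma sproj_seg_continuous a b : cross2 a b != 0 ->
  continuous (fun t : R => sproj (seg a b t)).
Proof.
move=> ab.
have lin (x y : R) : continuous (fun t : R => (1 - t) * x + t * y).
  move=> t; apply: cvgD; apply: cvgM; try exact: cvg_cst; last exact: cvg_id.
  by apply: cvgB; [exact: cvg_cst|exact: cvg_id].
have sq (x y : R) : continuous (fun t : R => ((1 - t) * x + t * y) ^+ 2).
  by move=> t; apply: cvgM; exact: lin.
have norm : continuous (fun t : R => (seg a b t).1.1 ^+ 2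
    + (seg a b t).1.2 ^+ 2 + (seg a b t).2 ^+ 2).
  by move=> t; apply: cvgD; [apply: cvgD|]; exact: sq.
have dist : continuous (fun t : R => pole_dist (seg a b t)).
  move=> t; apply: cvgB; last exact: lin.
  exact: (continuous_comp (norm t) (@sqrt_continuous R _)).
have dist_neq0 t : pole_dist (seg a b t) != 0.
  by rewrite lt0r_neq0 // pole_dist_gt0 // seg_off_axis.
have coord (x y : R) :
    continuous (fun t : R => ((1 - t) * x + t * y) / pole_dist (seg a b t)).
  by move=> t; apply: cvgM; [exact: lin|apply: cvgV => //; exact: dist].
move=> t.
exact: (cvg_pair (coord a.1.1 b.1.1 t) (coord a.1.2 b.1.2 t)).
Qed.

Lemma seg0 a b : seg a b 0 = a.
Proof. by case: a => [[x y] z]; rewrite /seg /lin2 /= subr0 !mul1r !mul0r !addr0. Qed.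

Lemma seg1 a b : seg a b 1 = b.
Proof. by case: b => [[x y] z]; rewrite /seg /lin2 /= subrr !mul1r !mul0r !add0r. Qed.

Lemma seg_inj a b k t t' : cross2 a b != 0 ->
  seg a b t = lin2 k 0 (seg a b t') (seg a b t') -> t = t'.
Proof.
move=> ab [e1 e2 _].
have tE : (t - k * t') * cross2 a b = 0.
  transitivity (a.1.1 * (((1 - t) * a.1.2 + t * b.1.2)
      - (k * ((1 - t') * a.1.2 + t' * b.1.2) + 0 * ((1 - t') * a.1.2 + t' * b.1.2)))
   - a.1.2 * (((1 - t) * a.1.1 + t * b.1.1)
      - (k * ((1 - t') * a.1.1 + t' * b.1.1) + 0 * ((1 - t') * a.1.1 + t' * b.1.1)))).
    by rewrite /cross2; ring.
  by rewrite e1 e2; ring.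
have sE : (1 - t - k * (1 - t')) * cross2 a b = 0.
  transitivity (b.1.2 * (((1 - t) * a.1.1 + t * b.1.1)
      - (k * ((1 - t') * a.1.1 + t' * b.1.1) + 0 * ((1 - t') * a.1.1 + t' * b.1.1)))
   - b.1.1 * (((1 - t) * a.1.2 + t * b.1.2)
      - (k * ((1 - t') * a.1.2 + t' * b.1.2) + 0 * ((1 - t') * a.1.2 + t' * b.1.2)))).
    by rewrite /cross2; ring.
  by rewrite e1 e2; ring.
move: tE sE => /eqP + /eqP; rewrite !mulf_eq0 (negbTE ab) !orbF.
move=> /eqP tE /eqP sE.
(* The sum of [t = k t'] and [1 - t = k (1 - t')] is [1 = k]. *)
have k1 : k = 1 by lra.
by move: tE; rewrite k1 mul1r => /eqP; rewrite subr_eq0 => /eqP.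
Qed.

End Projection.

(** * Drawings from points in space *)

Section SphericalDrawing.

Variables (R : realType) (G : sgraph) (v : G -> vec3 R).
Variable ends : {set G} -> G * G.

Hypothesis endsP : forall A, A \in edges G ->
  adj (ends A).1 (ends A).2 /\ A = [set (ends A).1; (ends A).2]%SET.
(** Assumed for nonadjacent vertices as well: it keeps segments off the axis and also separates the
    projected vertices. *)
Hypothesis v_cross2 : forall x y, x != y -> cross2 (v x) (v y) != 0.
(** General position: arcs avoid the other vertices, and no two distinct edges are coplanar with the
    origin. *)
Hypothesis v_det3 : forall x y z, adj x y -> z \notin [set x; y]%SET ->
  det3 (v x) (v y) (v z) != 0.

Implicit Types (A B : {set G}) (x y z : G).

Definition spherical_arc A (t : R) : R * R :=
  sproj (seg (v (ends A).1) (v (ends A).2) t).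

Lemma ends_cross2 A : A \in edges G ->
  cross2 (v (ends A).1) (v (ends A).2) != 0.
Proof. by move=> /endsP[/adj_neq/v_cross2]. Qed.

Lemma v_off_axis x y : x != y -> off_axis (v x).
Proof. by move=> /v_cross2 xy; have := seg_off_axis 0 xy; rewrite seg0. Qed.

Lemma sproj_v_inj : injective (fun x => sproj (v x)).
Proof.
move=> x y e; apply/eqP/negPn/negP => xy; have yx := xy; rewrite eq_sym in yx.
have [k _ vE] := sproj_inj (v_off_axis xy) (v_off_axis yx) e.
by have := v_cross2 xy; rewrite vE /cross2 /lin2 /= => /eqP; apply; ring.
Qed.

Lemma spherical_arc_continuous A : A \in edges G ->
  {within `[0, 1], continuous (spherical_arc A)}%classic.
Proof.
by move=> AE; apply/continuous_subspaceT/sproj_seg_continuous/ends_cross2.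
Qed.

Lemma spherical_arc_inj A : A \in edges G -> injective (spherical_arc A).
Proof.
move=> AE t t' e; have ab := ends_cross2 AE.
have [k _] := sproj_inj (seg_off_axis t ab) (seg_off_axis t' ab) e.
exact: seg_inj.
Qed.

Lemma spherical_arc_ends A : A \in edges G ->
  ([set spherical_arc A 0; spherical_arc A 1]
   = (fun x => sproj (v x)) @` [set` A])%classic.
Proof.
move=> AE; have [_ AE2] := endsP AE.
rewrite /spherical_arc seg0 seg1.
apply/seteqP; split=> p /=.
  have e1 : (ends A).1 \in A by rewrite {2}AE2 !inE eqxx.
  have e2 : (ends A).2 \in A by rewrite {2}AE2 !inE eqxx orbT.
  by case=> ->; [exists (ends A).1|exists (ends A).2].
by move=> [x +]; rewrite {1}AE2 !inE => /orP[]/eqP-> <-; [left|right].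
Qed.

Lemma spherical_arc_avoids A (t : R) x : A \in edges G ->
  t \in `]0, 1[ -> spherical_arc A t <> sproj (v x).
Proof.
move=> AE; rewrite in_itv /= => /andP[t0 t1] e.
have [Aadj AE2] := endsP AE; have ab := ends_cross2 AE.
have [xA|xA] := boolP (x \in A).
  move: xA; rewrite {1}AE2 !inE => /orP[]/eqP xE; move: e; rewrite xE.
    rewrite -[v (ends A).1](seg0 _ (v (ends A).2)) => /(spherical_arc_inj AE) t00.
    by rewrite t00 ltxx in t0.
  rewrite -[v (ends A).2](seg1 (v (ends A).1)) => /(spherical_arc_inj AE) t11.
  by rewrite t11 ltxx in t1.
(* Off [A], equal projections would put [v x] in the plane of the edge, against [v_det3]. *)
have xa : x != (ends A).1 by apply: contraNneq xA => ->; rewrite {2}AE2 !inE eqxx.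
have [k k0 vE] := sproj_inj (seg_off_axis t ab) (v_off_axis xa) e.
rewrite {1}AE2 in xA; have /eqP := v_det3 Aadj xA; apply.
apply: (mulfI (lt0r_neq0 k0)); rewrite mulr0.
transitivity (det3 (v (ends A).1) (v (ends A).2) (lin2 k 0 (v x) (v x))).
  by rewrite /det3 /lin2 /=; ring.
by rewrite -vE /det3 /seg /lin2 /=; ring.
Qed.

Definition spherical_drawing : drawing R G :=
  Drawing sproj_v_inj spherical_arc_continuous
    (fun A AE => in2W (spherical_arc_inj AE)) spherical_arc_ends
    spherical_arc_avoids.

Definition edges_cross A B : bool :=
  properly_cross (v (ends A).1) (v (ends A).2) (v (ends B).1) (v (ends B).2).

(** Equal projections are positive multiples in space, so the open cones of the two edges share a
    vector. The second conclusion is an affine equation for [t] free of [s]; it serves to show that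
    two arcs meet only once. *)
Lemma spherical_arcs_meet A B (t s : R) :
    A \in edges G -> B \in edges G -> B != A ->
    t \in `]0, 1[ -> s \in `]0, 1[ -> spherical_arc A t = spherical_arc B s ->
  edges_cross A B /\ (1 - t) * det3 (v (ends B).1) (v (ends B).2) (v (ends A).1)
    + t * det3 (v (ends B).1) (v (ends B).2) (v (ends A).2) = 0.
Proof.
move=> AE BE BA; rewrite !in_itv /= => /andP[t0 t1] /andP[s0 s1] e.
have ab := ends_cross2 AE; have cd := ends_cross2 BE.
have [k k0 vE] := sproj_inj (seg_off_axis t ab) (seg_off_axis s cd) e.
have {}vE : lin2 (1 - t) t (v (ends A).1) (v (ends A).2)
    = lin2 (k * (1 - s)) (k * s) (v (ends B).1) (v (ends B).2).
  by rewrite -/(seg _ _ _) vE /seg /lin2 /=; congr (_, _, _); ring.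
split; last first.
  transitivity (det3 (v (ends B).1) (v (ends B).2)
    (lin2 (1 - t) t (v (ends A).1) (v (ends A).2))); last rewrite vE;
  by rewrite /det3 /lin2 /=; ring.
apply: cones_meet_properly_cross vE; rewrite ?mulr_gt0 ?subr_gt0 //.
have [Aadj AE2] := endsP AE; have [Badj BE2] := endsP BE.
(* Both edges have two ends, so some end of [B] lies outside [A] and supplies the nonzero
   determinant. *)
have : ~~ (B \subset A).
  apply: contra BA => BsubA; rewrite eqEcard BsubA /=.
  by rewrite (card_edge AE) (card_edge BE).
rewrite {1}BE2 finset.subUset !finset.sub1set negb_and.
by case/orP; rewrite {1}AE2 => /(v_det3 Aadj) ->; rewrite ?orbT.
Qed.

(** Two arcs meet at most once: the affine equation for [t] has values of opposite signs at 0 and 1,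
    hence a single root. Counting crossings thus reduces to counting edges. *)
Lemma crossings_fst_inj A : A \in edges G ->
  {in crossings spherical_drawing A &, injective fst}.
Proof.
move=> AE [B p] [B' p']; rewrite !inE => -[/= BE BA [t t01 tp] [s s01 sp]].
move=> [/= _ _ [t' t01' tp'] [s' s01' sp']] BB'; rewrite -BB' in sp' *.
congr (_, _).
have [/and3P[_ cda _] e] := spherical_arcs_meet AE BE BA t01 s01 (etrans tp (esym sp)).
have [_ e'] := spherical_arcs_meet AE BE BA t01' s01' (etrans tp' (esym sp')).
suff tt' : t = t' by rewrite -tp -tp' tt'.
move: cda e e'; move: (det3 _ _ (v (ends A).1)) (det3 _ _ (v (ends A).2)) => q r.
move=> qr e e'.
have : (t - t') * (r - q) = 0.
  transitivity (((1 - t) * q + t * r) - ((1 - t') * q + t' * r)); first by ring.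
  by rewrite e e' subrr.
move/eqP; rewrite mulf_eq0 !subr_eq0 => /orP[/eqP//|/eqP rq].
by move: qr; rewrite rq ltNge sqr_ge0.
Qed.

Lemma spherical_kplanar k :
  (forall A, A \in edges G -> #|[set B in edges G | edges_cross A B]%SET| <= k)%N ->
  kplanar R k G.
Proof.
move=> crossk; exists spherical_drawing => A AE.
pose K := [set B in edges G | edges_cross A B]%SET.
(* The position of the crossing edge in [enum K] injects the crossings into [I_k]. *)
pose rank (Bp : {set G} * (R * R)) := index Bp.1 (enum K).
have crossK Bp : crossings spherical_drawing A Bp -> Bp.1 \in enum K.
  case: Bp => B p [/= BE BA [t t01 tp] [s s01 sp]].
  rewrite mem_enum inE BE /=.
  by have [] := spherical_arcs_meet AE BE BA t01 s01 (etrans tp (esym sp)).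
have rank_inj : {in crossings spherical_drawing A &, injective rank}.
  move=> Bp Bp' BpA Bp'A e; apply: (crossings_fst_inj AE) => //.
  have BpK := crossK _ (set_mem BpA); have Bp'K := crossK _ (set_mem Bp'A).
  by rewrite -(nth_index finset.set0 BpK) -(nth_index finset.set0 Bp'K) [index _ _]e.
rewrite -(card_le_eql (inj_card_eq rank_inj)); apply: subset_card_le => _ [Bp BpA <-].
by rewrite /= (leq_trans _ (crossk A AE)) // cardE index_mem crossK.
Qed.

End SphericalDrawing.

(** * The drawing of the dodecahedron with diagonals *)

(* A regular dodecahedron, rounded after a generic affine map so that the plane
   through the origin and any edge of the graph contains no third vertex. *)
Local Open Scope Z_scope.
Definition dodeca_point : nat -> vec3 Z := nth (0, 0, 0)
  [:: (3, 4, 6); (0, 7, 6); (-3, 2, 6); (-1, -3, 6); (2, -2, 6);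
      (4, 5, 1); (-1, 9, 1); (-5, 2, 1); (-2, -7, 1); (4, -5, 1);
      (2, 8, -2); (-3, 6, -2); (-4, -4, -2); (1, -8, -2); (5, -1, -2);
      (2, 4, -7); (-2, 3, -7); (-2, -3, -7); (1, -6, -7); (3, -1, -7)].
Local Close Scope Z_scope.

Definition nat_pairs n := [seq (i, j) | i <- iota 0 n, j <- iota 0 n].

Definition dodeca_edge (p : nat * nat) : bool :=
  (p.1 < p.2)%N && table_adj p.1 p.2.

Definition dodeca_edges : seq (nat * nat) :=
  [seq p <- nat_pairs 20 | dodeca_edge p].

Definition dodeca_cross (p q : nat * nat) : bool :=
  properly_cross (dodeca_point p.1) (dodeca_point p.2)
                 (dodeca_point q.1) (dodeca_point q.2).

Lemma dodeca_cross2_check : all (fun p => (p.1 != p.2) ==>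
  (cross2 (dodeca_point p.1) (dodeca_point p.2) != 0)) (nat_pairs 20).
Proof. by vm_compute. Qed.

Lemma dodeca_det3_check : all (fun p => all (fun z =>
    [|| z == p.1, z == p.2 |
     det3 (dodeca_point p.1) (dodeca_point p.2) (dodeca_point z) != 0])
  (iota 0 20)) [seq p <- nat_pairs 20 | table_adj p.1 p.2].
Proof. by vm_compute. Qed.

(** In a convex pentagon each diagonal crosses two others, so 2 is the expected maximum. An edge is
    not counted against itself or an adjacent edge, since a determinant with a repeated vector
    vanishes. *)
Lemma dodeca_cross_check :
  all (fun p => count (dodeca_cross p) dodeca_edges <= 2)%N dodeca_edges.
Proof. by vm_compute. Qed.

Lemma mem_nat_pairs n i j : ((i, j) \in nat_pairs n) = (i < n)%N && (j < n)%N.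
Proof.
apply/allpairsP/andP => [[[i' j'] /= [+ + [-> ->]]]|[iN jN]].
  by rewrite !mem_iota.
by exists (i, j); rewrite !mem_iota.
Qed.

Lemma card_ord_pairs n (P : pred (nat * nat)) :
  #|[set p : 'I_n * 'I_n | P (val p.1, val p.2)]%SET| = count P (nat_pairs n).
Proof.
rewrite cardE -(size_map (fun p : 'I_n * 'I_n => (val p.1, val p.2))) -size_filter.
apply/perm_size/uniq_perm.
- rewrite map_inj_uniq ?enum_uniq // => -[i j] [i' j'] [ii' jj'].
  by congr (_, _); exact: val_inj.
- by rewrite filter_uniq // allpairs_uniq ?iota_uniq // => -[? ?] [? ?].
move=> [i j]; rewrite mem_filter mem_nat_pairs; apply/mapP/idP.
  by move=> [[i' j']]; rewrite mem_enum inE /= => Pij [-> ->]; rewrite Pij !ltn_ord.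
move=> /andP[Pij /andP[iN jN]]; exists (Ordinal iN, Ordinal jN) => //.
by rewrite mem_enum inE.
Qed.

(** Edges are oriented towards the larger number, as in [dodeca_edges]; the default pair arises only
    for sets that are not edges. *)
Definition dodeca_ends (A : {set dodeca}) : 'I_20 * 'I_20 :=
  odflt (ord0, ord0) [pick p : 'I_20 * 'I_20 |
    dodeca_edge (val p.1, val p.2) && (A == [set p.1; p.2]%SET)].

Lemma dodeca_endsP (A : {set dodeca}) : A \in edges dodeca ->
  dodeca_edge (val (dodeca_ends A).1, val (dodeca_ends A).2) /\
  A = [set (dodeca_ends A).1; (dodeca_ends A).2]%SET.
Proof.
move=> AE; rewrite /dodeca_ends; case: pickP => [p /andP[pE /eqP AE2]|no] //.
have [x [y [xy AE2]]] := edgesP _ AE.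
have : (val x != val y) := adj_neq xy; rewrite neq_ltn => /orP[lt_xy|lt_yx].
  by have /= := no (x, y); rewrite /dodeca_edge table_adjE xy lt_xy AE2 eqxx.
have /= := no (y, x); rewrite /dodeca_edge table_adjE adj_sym xy lt_yx AE2.
by rewrite finset.setUC eqxx.
Qed.

(** The 30 sides and 60 diagonals correspond to the increasing adjacent pairs, which are counted by
    computation. *)
Lemma card_dodeca_edges : #|edges dodeca| = 90%N.
Proof.
have -> : edges dodeca = [set [set p.1; p.2]%SET | p in
    [set p : 'I_20 * 'I_20 | dodeca_edge (val p.1, val p.2)]]%SET.
  apply/setP => A; apply/idP/imsetP.
    by move=> /dodeca_endsP[AE ?]; exists (dodeca_ends A); rewrite ?finset.in_set.
  move=> [[x y]]; rewrite finset.in_set /dodeca_edge table_adjE => /andP[_ xy] ->.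
  by apply/edgesP; exists x, y.
rewrite card_in_imset => [|[x y] [x' y']].
  by rewrite card_ord_pairs; vm_compute.
rewrite !finset.in_set => /andP[/= xy _] /andP[/= xy' _] /setP e.
have := e x; have := e y; rewrite !inE !eqxx orbT /=.
move=> /esym/orP[]/eqP yE /esym/orP[]/eqP xE; rewrite ?xE ?yE // in xy xy' *.
- by rewrite ltnn in xy.
- by have := ltn_trans xy xy'; rewrite ltnn.
- by rewrite ltnn in xy.
Qed.

(** * Transfer from integer coordinates to the reals *)

Section Realization.

Variable R : realType.

(** The checks run on binary integers. Determinants are integer polynomials, so they commute with
    this ring morphism, which preserves signs. *)
Definition real_of_Z (z : Z) : R := (int_of_Z z)%:~R.

Lemma real_of_Z_eq0 z : (real_of_Z z == 0) = (z == 0).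
Proof.
by rewrite intr_eq0 -(inj_eq (can_inj int_of_ZK)).
Qed.

Lemma real_of_Z_lt0 z : (real_of_Z z < 0) = (z < 0).
Proof. by rewrite ltrz0; case: z. Qed.

Lemma real_of_ZM x y : real_of_Z (x * y) = real_of_Z x * real_of_Z y.
Proof. by rewrite /real_of_Z !rmorphM. Qed.

Definition dodeca_vec (x : dodeca) : vec3 R :=
  map_vec3 real_of_Z (dodeca_point x).

Lemma cross2_real_of_Z (u v : vec3 Z) :
  cross2 (map_vec3 real_of_Z u) (map_vec3 real_of_Z v) = real_of_Z (cross2 u v).
Proof. by rewrite /cross2 /real_of_Z /= !(rmorphB, rmorphM). Qed.

Lemma det3_real_of_Z (u v w : vec3 Z) :
  det3 (map_vec3 real_of_Z u) (map_vec3 real_of_Z v) (map_vec3 real_of_Z w)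
  = real_of_Z (det3 u v w).
Proof. by rewrite /det3 /real_of_Z /= !(rmorphD, rmorphN, rmorphM). Qed.

Lemma dodeca_2planar : kplanar R 2 dodeca.
Proof.
apply: (@spherical_kplanar R dodeca dodeca_vec dodeca_ends).
- move=> A /dodeca_endsP[+ AE].
  by rewrite /dodeca_edge table_adjE => /andP[_ Aadj].
- move=> x y xy; rewrite cross2_real_of_Z real_of_Z_eq0.
  have /allP/(_ (val x, val y)) := dodeca_cross2_check.
  by rewrite mem_nat_pairs !ltn_ord => /(_ isT) /implyP; apply.
- move=> x y z xy; rewrite !inE negb_or => /andP[zx zy].
  rewrite det3_real_of_Z real_of_Z_eq0.
  have xyE : (val x, val y) \in [seq p <- nat_pairs 20 | table_adj p.1 p.2].
    by rewrite mem_filter mem_nat_pairs !ltn_ord /= table_adjE xy.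
  have /allP/(_ _ xyE) := dodeca_det3_check.
  move=> /allP/(_ (val z)); rewrite mem_iota ltn_ord => /(_ isT).
  by rewrite -!val_eqE in zx zy; rewrite (negbTE zx) (negbTE zy).
move=> A /dodeca_endsP[AE _].
have /allP/(_ (val (dodeca_ends A).1, val (dodeca_ends A).2)) := dodeca_cross_check.
rewrite mem_filter AE mem_nat_pairs !ltn_ord => /(_ isT).
apply: leq_trans; rewrite count_filter -card_ord_pairs.
(* Edges are determined by their ordered ends, so those crossing [A] inject into the pairs counted
   by the check. *)
rewrite -(card_in_imset (f := dodeca_ends)).
  apply/subset_leq_card/fintype.subsetP => p /imsetP[B].
  rewrite finset.in_set [B \in _]inE => /andP[/dodeca_endsP[BE _] cross] ->.
  apply/andP; split=> //; move: cross.
  by rewrite /edges_cross /properly_cross !det3_real_of_Z -!real_of_ZM !real_of_Z_lt0.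
move=> B B'; rewrite [B \in _]inE [B' \in _]inE.
move=> /andP[/dodeca_endsP[_ BE] _] /andP[/dodeca_endsP[_ BE'] _] e.
by rewrite BE BE' e.
Qed.

End Realization.

Local Close Scope ring_scope.

Theorem mainTheorem6 (R : realType) :
  optimal_2planar R dodecahedron_with_diagonals /\
  extendable 4 dodecahedron_with_diagonals.
Proof.
split; last exact: dodeca_extendable.
split; first exact: dodeca_2planar.
by rewrite card_dodeca_edges card_ord.
Qed.
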